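(* Let $\theta>0$ be such that there is at least one $\mathbf a$ with $(\theta,\mathbf a)\in\mathcal D$. Then the optimal portfolio in the alternative worst-case approach, $$\mathbf a^\star(\theta)=\arg\inf_{\mathbf a:\,(\theta,\mathbf a)\in\mathcal D}\ \frac1\theta\ln\mathbb E\left[\exp(\theta V_{\mathbf a}(\mathbf X))\right],$$ is $$\mathbf a^\star(\theta)=\frac{1}{\Gamma(S^\star(\theta);\theta,\gamma)}\,\Sigma^{-1}\boldsymbol\mu+\left(1-\frac{A}{\Gamma(S^\star(\theta);\theta,\gamma)}\right)\frac{\Sigma^{-1}\mathbf 1}{C},$$ where $S^\star(\theta)$ is the unique solution $S$ with $\frac1C\le S<\frac{1}{\theta\gamma}$ of the equation $$S=\frac1C\left(\frac{D}{\Gamma(S;\theta,\gamma)^2}+1\right).$$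
   Context: Let $n\ge1$, $\boldsymbol\mu\in\mathbb R^n$, $\Sigma\in\mathbb R^{n\times n}$ symmetric positive definite, $\gamma>0$, and let $\mathbf X\sim N(\boldsymbol\mu,\Sigma)$ under the nominal model, with expectation $\mathbb E$. Let $\mathbf 1\in\mathbb R^n$ be the all-ones vector and $\mathcal A=\{\mathbf a\in\mathbb R^n:\mathbf a^T\mathbf 1=1\}$ the set of portfolios. Mean-variance measure of risk: $V_{\mathbf a}(\mathbf X)=\frac\gamma2\,\mathbf a^T(\mathbf X-\boldsymbol\mu)(\mathbf X-\boldsymbol\mu)^T\mathbf a-\mathbf a^T\mathbf X$. Domain: $\mathcal D=\{(\theta,\mathbf a):\theta>0,\ \mathbf a\in\mathcal A,\ \theta\,\mathbf a^T\Sigma\,\mathbf a<1/\gamma\}$. Constants: $A=\mathbf 1^T\Sigma^{-1}\boldsymbol\mu$, $B=\boldsymbol\mu^T\Sigma^{-1}\boldsymbol\mu$, $C=\mathbf 1^T\Sigma^{-1}\mathbf 1$, $D=BC-A^2$. For $\theta\gamma S<1$: $\Gamma(S;\theta,\gamma)=\dfrac{\gamma(1-\theta\gamma S)+\theta}{(1-\theta\gamma S)^2}$. *)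

(* Defs.v *)
From HB Require Import structures.
From mathcomp Require Export all_boot all_order all_algebra.
From mathcomp Require Export all_classical all_reals all_analysis.
Export Order.TTheory GRing.Theory Num.Theory numFieldNormedType.Exports.

Set Implicit Arguments.
Unset Strict Implicit.
Unset Printing Implicit Defensive.

Global Open Scope classical_set_scope.
Global Open Scope ring_scope.

Section Definitions.
Variable R : realType.

Section Vectors.
Variable n : nat.
Implicit Types (x y mu a : 'cV[R]_n) (Sigma : 'M[R]_n).

Definition dot x y : R := (x^T *m y) 0 0.

Definition bilin Sigma x y : R := (x^T *m Sigma *m y) 0 0.

Definition ones : 'cV[R]_n := const_mx 1.

Definition sym_posdef Sigma : Prop :=
  Sigma^T = Sigma /\ forall x, x != 0 -> 0 < bilin Sigma x x.

Definition portfolio : set 'cV[R]_n := [set a | dot a ones = 1].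

Definition domain (gamma : R) Sigma : set (R * 'cV[R]_n) :=
  [set p | [/\ 0 < p.1, portfolio p.2 &
               p.1 * bilin Sigma p.2 p.2 < gamma^-1]].

(* The mean-variance measure of risk V_a(X), as a function of the value x
   taken by X. *)
Definition MV (gamma : R) mu a x : R :=
  gamma / 2 * (a^T *m (x - mu) *m (x - mu)^T *m a) 0 0 - dot a x.

Definition constA Sigma mu : R := bilin (invmx Sigma) ones mu.
Definition constB Sigma mu : R := bilin (invmx Sigma) mu mu.
Definition constC Sigma : R := bilin (invmx Sigma) ones ones.
Definition constD Sigma mu : R :=
  constB Sigma mu * constC Sigma - constA Sigma mu ^+ 2.

Definition Gamma (S theta gamma : R) : R :=
  (gamma * (1 - theta * gamma * S) + theta) / (1 - theta * gamma * S) ^+ 2.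

Definition solves_S (theta gamma : R) Sigma mu (S : R) : Prop :=
  [/\ (constC Sigma)^-1 <= S, S < (theta * gamma)^-1 &
      S = (constC Sigma)^-1 *
            (constD Sigma mu / Gamma S theta gamma ^+ 2 + 1)].

Definition opt_portfolio (theta gamma : R) Sigma mu (S : R) : 'cV[R]_n :=
  (Gamma S theta gamma)^-1 *: (invmx Sigma *m mu)
  + (1 - constA Sigma mu / Gamma S theta gamma)
      *: ((constC Sigma)^-1 *: (invmx Sigma *m ones)).

(* X ~ N(mu, Sigma) for Sigma positive definite, by the usual definition: every
   linear combination a^T X of the coordinates is univariate normal, with mean
   a^T mu and variance a^T Sigma a.  The library's normal_prob takes the
   standard deviation, and it is not the point mass when that is 0; the
   combination a = 0 is identically 0 and is left out. *)
Definition normal_vector d (T : measurableType d) (P : probability T R)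
    (X : T -> 'cV[R]_n) mu Sigma : Prop :=
  (forall i, measurable_fun setT (fun w => X w i 0)) /\
  (forall a, a != 0 -> forall E : set R, measurable E ->
     P ((fun w => dot a (X w)) @^-1` E) =
     normal_prob (dot a mu) (Num.sqrt (bilin Sigma a a)) E).

(* Extended-real valued: it would be +oo if the expectation were infinite. *)
Definition worst_case d (T : measurableType d) (P : probability T R)
    (X : T -> 'cV[R]_n) (gamma theta : R) mu a : \bar R :=
  ((theta^-1)%:E * lne 'E_P[fun w => expR (theta * MV gamma mu a (X w))%R])%E.

End Vectors.

Definition arg_inf (U : Type) (D : set U) (f : U -> \bar R) : set U :=
  [set a | D a /\ f a = ereal_inf (f @` D)].

End Definitions.

Arguments ones {R n}.
Arguments portfolio {R n}.

(* Main.v *)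
(* Completing the square in the Gaussian integral gives, for a in the domain,
     (1/theta) ln E[exp (theta V_a)] = F (a^T Sigma a) - a^T mu
   with F convex and F' = Gamma / 2.  Let a* be the efficient portfolio
   g Sigma^-1 mu + (1 - A g) Sigma^-1 1 / C; its variance is (D g^2 + 1) / C, so
   the equation for S* says that a* has variance S* when g = 1 / Gamma(S* ).
   Since Sigma a* is g mu plus a multiple of 1, every portfolio a satisfies
     a^T Sigma a - S* = 2 g (a - a* )^T mu + (a - a* )^T Sigma (a - a* ),
   and the tangent inequality for F at S* makes the cost of a exceed that of a*
   by at least (Gamma / 2) (a - a* )^T Sigma (a - a* ).  S* exists by the
   intermediate value theorem and is unique because Gamma is increasing. *)
From HB Require Import structures.
Require Import Defs.
From mathcomp Require Import measurable_realfun ring lra.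

Set Implicit Arguments.
Unset Strict Implicit.
Unset Printing Implicit Defensive.

(** * Linear algebra of [dot] and [bilin] *)

Section Dot.
Context {R : realType} {n : nat}.
Implicit Types (a x y z mu : 'cV[R]_n) (M : 'M[R]_n).

Lemma dotC x y : dot x y = dot y x.
Proof. by rewrite /dot -[in LHS](trmxK y) -trmx_mul mxE. Qed.

Lemma dotDl x y z : dot (x + y) z = dot x z + dot y z.
Proof. by rewrite /dot linearD/= mulmxDl mxE. Qed.

Lemma dotZl c x y : dot (c *: x) y = c * dot x y.
Proof. by rewrite /dot linearZ/= -scalemxAl mxE. Qed.

Lemma dotDr x y z : dot x (y + z) = dot x y + dot x z.
Proof. by rewrite dotC dotDl !(dotC x). Qed.

Lemma dotZr c x y : dot x (c *: y) = c * dot x y.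
Proof. by rewrite dotC dotZl dotC. Qed.

Lemma dotBl x y z : dot (x - y) z = dot x z - dot y z.
Proof. by rewrite dotDl -scaleN1r dotZl mulN1r. Qed.

Lemma dotBr x y z : dot x (y - z) = dot x y - dot x z.
Proof. by rewrite !(dotC x) dotBl. Qed.

Lemma bilinE M x y : bilin M x y = dot x (M *m y).
Proof. by rewrite /bilin /dot mulmxA. Qed.

Lemma dot_mulmxl M x y : dot (M *m x) y = dot x (M^T *m y).
Proof. by rewrite /dot trmx_mul mulmxA. Qed.

(** The matrix product is the square of the scalar a^T (x - mu), so the risk depends on x only
    through a^T x. *)
Lemma MVE gamma mu a x :
  MV gamma mu a x = gamma / 2 * (dot a x - dot a mu) ^+ 2 - dot a x.
Proof.
rewrite /MV -mulmxA mxE big_ord1 -dotBr expr2.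
by rewrite -[((x - mu)^T *m a) 0 0]/(dot (x - mu) a) (dotC _ a).
Qed.

(** [normal_vector] gives the law of a^T X only for nonzero a. *)
Lemma portfolio_neq0 a : portfolio a -> a != 0.
Proof.
apply: contraPneq => ->; rewrite /portfolio/=.
rewrite -(scale0r (0 : 'cV[R]_n)) dotZl mul0r.
by move/esym/eqP; rewrite oner_eq0.
Qed.

End Dot.

(** * Positive definite matrices *)

Section PositiveDefinite.
Context {R : realType} {n : nat}.
Variables (Sigma : 'M[R]_n) (Sigma_pd : sym_posdef Sigma).
Implicit Types (x : 'cV[R]_n).

Lemma bilin_ge0 x : 0 <= bilin Sigma x x.
Proof.
have [->|x0] := eqVneq x 0; last exact/ltW/Sigma_pd.2.
by rewrite bilinE -(scale0r (0 : 'cV[R]_n)) dotZl mul0r.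
Qed.

Lemma sym_posdef_unitmx : Sigma \in unitmx.
Proof.
rewrite -row_free_unit; apply: inj_row_free => v vS.
apply/eqP; apply: contra_eqT vS => v0.
have vT0 : v^T != 0 by rewrite trmx_eq0.
have := Sigma_pd.2 _ vT0; rewrite /bilin trmxK.
by apply: contraTneq => ->; rewrite mul0mx mxE ltxx.
Qed.

Lemma constC_gt0 : (0 < n)%N -> 0 < constC Sigma.
Proof.
move=> n0; have SU := sym_posdef_unitmx.
(* With w = Sigma^-1 1, the constant C is w^T Sigma w. *)
rewrite /constC bilinE -{1}(mulKVmx SU ones) dot_mulmxl Sigma_pd.1 -bilinE.
apply: Sigma_pd.2.
apply/negP => /eqP w0.
have : (ones : 'cV[R]_n) = 0 by rewrite -(mulKVmx SU ones) w0 mulmx0.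
by move/matrixP => /(_ (Ordinal n0) 0) /eqP; rewrite !mxE oner_eq0.
Qed.

End PositiveDefinite.

(** * Efficient portfolios and their variances *)

Section Frontier.
Context {R : realType} {n : nat}.
Variables (mu : 'cV[R]_n) (Sigma : 'M[R]_n) (Sigma_pd : sym_posdef Sigma).
Variable (n_gt0 : (0 < n)%N).
Implicit Types (x : 'cV[R]_n) (g : R).
Local Notation A := (constA Sigma mu).
Local Notation B := (constB Sigma mu).
Local Notation C := (constC Sigma).
Local Notation D := (constD Sigma mu).

(* [opt_portfolio] with [Gamma^-1] replaced by a free parameter [g]; these are
   the mean-variance efficient portfolios, [g = 0] having the least variance. *)
Definition frontier g : 'cV[R]_n :=
  g *: (invmx Sigma *m mu)
  + (1 - A * g) *: (C^-1 *: (invmx Sigma *m ones)).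

Let SU : Sigma \in unitmx := sym_posdef_unitmx Sigma_pd.
Let C0 : C != 0. Proof. by rewrite gt_eqF// constC_gt0. Qed.

Let mulmx_frontier g :
  Sigma *m frontier g = g *: mu + ((1 - A * g) / C) *: ones.
Proof. by rewrite mulmxDr !linearZ/= !mulKVmx// scalerA. Qed.

Let invmx_sym x : dot (invmx Sigma *m mu) x = dot mu (invmx Sigma *m x).
Proof. by rewrite dot_mulmxl trmx_inv Sigma_pd.1. Qed.

Lemma portfolio_frontier g : portfolio (frontier g).
Proof.
rewrite /portfolio/= dotDl !dotZl !(dotC (_ *m _)) -!bilinE.
rewrite -/(constA Sigma mu) -/(constC Sigma); field.
exact: C0.
Qed.

Lemma dot_frontier_mean g :
  dot (frontier g) mu = g * B + (1 - A * g) / C * A.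
Proof.
rewrite dotDl !dotZl !(dotC _ mu) -!bilinE -/(constB Sigma mu).
by rewrite bilinE -invmx_sym dotC -bilinE -/(constA Sigma mu) mulrA.
Qed.

Lemma bilin_frontier g :
  bilin Sigma (frontier g) (frontier g) = C^-1 * (D * g ^+ 2 + 1).
Proof.
rewrite bilinE mulmx_frontier dotDr !dotZr portfolio_frontier.
rewrite dot_frontier_mean /constD; field.
exact: C0.
Qed.

(** The component of [Sigma *m frontier g] along [ones] pairs equally with the two portfolios and
    cancels. *)
Lemma bilin_sub_frontier g x : portfolio x ->
  bilin Sigma x x - bilin Sigma (frontier g) (frontier g) =
  2 * g * (dot x mu - dot (frontier g) mu)
  + bilin Sigma (x - frontier g) (x - frontier g).
Proof.
move=> x1; set f := frontier g.
have xf : dot x (Sigma *m f) = g * dot x mu + (1 - A * g) / C.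
  by rewrite mulmx_frontier dotDr !dotZr x1 mulr1.
have ff : dot f (Sigma *m f) = g * dot f mu + (1 - A * g) / C.
  by rewrite mulmx_frontier dotDr !dotZr portfolio_frontier mulr1.
have fx : dot f (Sigma *m x) = dot x (Sigma *m f).
  by rewrite dotC dot_mulmxl Sigma_pd.1.
rewrite !bilinE mulmxBr !dotBl !dotBr fx xf ff; ring.
Qed.

End Frontier.

Lemma bilin_portfolio_ge (R : realType) (n : nat) (Sigma : 'M[R]_n)
    (x : 'cV[R]_n) : sym_posdef Sigma -> (0 < n)%N -> portfolio x ->
  (constC Sigma)^-1 <= bilin Sigma x x.
Proof.
move=> Sigma_pd n_gt0 x1.
(* At g = 0 the frontier portfolio has variance 1/C, and the excess variance of x over it is a pure
   quadratic form. *)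
have := bilin_frontier 0 Sigma_pd n_gt0 0.
rewrite expr0n mulr0 add0r mulr1 => <-.
by rewrite -subr_ge0 bilin_sub_frontier// mulr0 mul0r add0r bilin_ge0.
Qed.

(** This is Cauchy-Schwarz for Sigma^-1, read off the frontier: the portfolio at g = 1 has variance
    (D + 1)/C, which cannot be below 1/C. *)
Lemma constD_ge0 (R : realType) (n : nat) (mu : 'cV[R]_n) (Sigma : 'M[R]_n) :
  sym_posdef Sigma -> (0 < n)%N -> 0 <= constD Sigma mu.
Proof.
move=> Sigma_pd n_gt0.
have f1 := portfolio_frontier mu Sigma_pd n_gt0 1.
have := bilin_portfolio_ge Sigma_pd n_gt0 f1.
rewrite bilin_frontier// expr1n mulr1 ler_pMr ?invr_gt0 ?constC_gt0//.
by rewrite lerDr.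
Qed.

(** * Change of variables and Gaussian integrals *)

Lemma ge0_integral_law d1 d2 (T1 : measurableType d1) (T2 : measurableType d2)
    (R : realType) (mu : {measure set T1 -> \bar R})
    (nu : {measure set T2 -> \bar R}) (Y : {mfun T1 >-> T2})
    (f : T2 -> \bar R) :
  (forall E, measurable E -> mu (Y @^-1` E) = nu E) ->
  measurable_fun setT f -> (forall y, 0 <= f y)%E ->
  (\int[mu]_x f (Y x) = \int[nu]_y f y)%E.
Proof.
move=> lawY mf f0.
have := ge0_integral_pushforward (measurable_funPT Y) mu measurableT mf.
rewrite preimage_setT => <-; last by move=> y _; exact: f0.
by apply: eq_measure_integral => E mE _; exact: lawY.
Qed.

Section NormalIntegral.
Context {R : realType}.

Lemma ge0_integral_normal_prob (m s : R) (f : measurableTypeR R -> \bar R) :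
  measurable_fun setT f -> (forall x, 0 <= f x)%E ->
  (\int[normal_prob m s]_x f x
   = \int[@lebesgue_measure R]_x (f x * (normal_pdf m s x)%:E))%E.
Proof.
move=> mf f0.
have dom := @normal_prob_dominates R m s.
have mpdf : measurable_fun setT (fun x => (normal_pdf m s x)%:E).
  by apply/measurable_EFinP; exact: measurable_normal_pdf.
rewrite -(Radon_Nikodym_SigmaFinite.change_of_variables dom)//.
have int_f := Radon_Nikodym_SigmaFinite.f_integrable dom.
apply: ae_eq_integral => //.
- by apply: emeasurable_funM => //; exact: measurable_int int_f.
- exact: emeasurable_funM.
(* The Radon-Nikodym derivative agrees almost everywhere with [normal_pdf], since both integrate to
   [normal_prob] over every measurable set. *)
- apply: ae_eqe_mul2l; apply: integral_ae_eq => // E _ mE.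
  by rewrite -Radon_Nikodym_SigmaFinite.f_integral.
Qed.

(* The tilted density is a multiple of the density of
   N(m - theta v / q, v / q), where q = 1 - theta gamma v. *)
Lemma expR_mul_normal_pdf (theta gamma m v y : R) :
  0 < v -> 0 < 1 - theta * gamma * v ->
  expR (theta * (gamma / 2 * (y - m) ^+ 2 - y)) * normal_pdf m (Num.sqrt v) y =
  (Num.sqrt (1 - theta * gamma * v))^-1
    * expR (theta ^+ 2 * v / (2 * (1 - theta * gamma * v)) - theta * m)
  * normal_pdf (m - theta * v / (1 - theta * gamma * v))
      (Num.sqrt (v / (1 - theta * gamma * v))) y.
Proof.
set q := 1 - _ => v0 q0.
have vq0 : 0 < v / q by rewrite divr_gt0.
rewrite !normal_pdfE ?gt_eqF ?sqrtr_gt0// /normal_peak /normal_fun.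
rewrite !sqr_sqrtr ?ltW//.
rewrite (_ : v * pi *+ 2 = q * (v / q * pi *+ 2)); last first.
  by field; rewrite gt_eqF.
rewrite (sqrtrM _ (ltW q0)) invfM.
rewrite mulrCA -expRD [RHS]mulrACA -expRD; congr (_ * expR _).
rewrite /q in q0 *; field.
by rewrite gt_eqF// gt_eqF.
Qed.

Lemma integral_expR_normal_prob (theta gamma m v : R) :
  0 < v -> 0 < 1 - theta * gamma * v ->
  (\int[normal_prob m (Num.sqrt v)]_y
     (expR (theta * (gamma / 2 * (y - m) ^+ 2 - y)))%:E)%E =
  ((Num.sqrt (1 - theta * gamma * v))^-1
    * expR (theta ^+ 2 * v / (2 * (1 - theta * gamma * v)) - theta * m))%:E.
Proof.
move=> v0 q0; rewrite ge0_integral_normal_prob; last 2 first.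
- apply/measurable_EFinP/measurableT_comp => //.
  apply: measurable_funM => //; apply: measurable_funB => //.
  apply: measurable_funM => //; apply: measurable_funX.
  exact: measurable_funB.
- by move=> y; rewrite lee_fin expR_ge0.
(* After tilting, the remaining normal density has integral 1 and only the constant survives. *)
under eq_integral do rewrite -EFinM expR_mul_normal_pdf// EFinM.
rewrite integralZl//; last exact: integrable_normal_pdf.
by rewrite integral_normal_pdf mule1.
Qed.

End NormalIntegral.

(** * The cost of variance and the fixed-point equation *)

Section RiskCost.
Context {R : realType}.
Variables (theta gamma : R) (theta_gt0 : 0 < theta) (gamma_gt0 : 0 < gamma).
Implicit Types (S V : R).

(** The logarithm of the Gaussian integral divided by theta, without its mean term; S is the
    variance. *)
Definition variance_cost S : R :=
  theta * S / (2 * (1 - theta * gamma * S))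
  - ln (1 - theta * gamma * S) / (2 * theta).

Lemma domain_slack S : (0 < 1 - theta * gamma * S) = (S < (theta * gamma)^-1).
Proof.
by rewrite subr_gt0 -(ltr_pdivlMl _ _ (mulr_gt0 theta_gt0 gamma_gt0)) mulr1.
Qed.

Lemma Gamma_gt0 S : S < (theta * gamma)^-1 -> 0 < Gamma S theta gamma.
Proof.
rewrite -domain_slack => q0; rewrite divr_gt0 ?exprn_gt0//.
by rewrite addr_gt0// mulr_gt0.
Qed.

(* [Gamma S / 2] is the derivative of the convex function [variance_cost]. *)
Lemma variance_cost_tangent S V :
  S < (theta * gamma)^-1 -> V < (theta * gamma)^-1 ->
  variance_cost S + Gamma S theta gamma / 2 * (V - S) <= variance_cost V.
Proof.
rewrite -!domain_slack /variance_cost /Gamma.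
set q := 1 - theta * gamma * S; set p := 1 - theta * gamma * V => q0 p0.
have VE : V = (1 - p) / (theta * gamma).
  by rewrite /p; field; rewrite !gt_eqF.
have SE : S = (1 - q) / (theta * gamma).
  by rewrite /q; field; rewrite !gt_eqF.
rewrite {}VE {}SE; move: p q => {S V}p q in p0 q0 *.
have lnpq : ln p - ln q <= p / q - 1.
  rewrite -ln_div ?posrE//; have := @le_ln1Dx R (p / q - 1).
  by rewrite subrKC; apply; rewrite ltrBrDl subrr divr_gt0.
rewrite -subr_ge0.
(* The gap to the tangent splits into the defect in ln(p/q) <= p/q - 1, coming from the logarithm,
   and a square, coming from the rational term. *)
rewrite (_ : _ - _ = (p / q - 1 - (ln p - ln q)) / (2 * theta)
    + (p - q) ^+ 2 / (2 * gamma * p * q ^+ 2)); last first.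
  by field; rewrite !gt_eqF.
rewrite addr_ge0// divr_ge0 ?subr_ge0 ?sqr_ge0//.
  by rewrite ltW// mulr_gt0.
by rewrite !mulr_ge0 ?exprn_ge0// ltW.
Qed.

(** The reciprocal of [Gamma], written so that the denominator stays at least theta up to and
    including S = 1/(theta gamma), where the value is 0. *)
Let gap S := (1 - theta * gamma * S) ^+ 2
  / (gamma * (1 - theta * gamma * S) + theta).

Let Gamma_inv S : (Gamma S theta gamma)^-1 = gap S.
Proof. by rewrite /Gamma invf_div. Qed.

Lemma ler_invGamma S V : S <= V -> V < (theta * gamma)^-1 ->
  (Gamma V theta gamma)^-1 <= (Gamma S theta gamma)^-1.
Proof.
move=> SV; rewrite -domain_slack !Gamma_inv /gap => p0.
have : 1 - theta * gamma * V <= 1 - theta * gamma * S.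
  by rewrite lerD2l lerN2 ler_pM2l// mulr_gt0.
move: p0; move: (1 - _) (1 - _) => q p p0 pq.
have q0 : 0 < q by exact: lt_le_trans pq.
rewrite ler_pdivrMr ?addr_gt0 ?mulr_gt0// mulrAC.
rewrite ler_pdivlMr ?addr_gt0 ?mulr_gt0//.
(* Monotonicity of q^2 / (gamma q + theta) in q: the cross-multiplied difference has the factor q -
   p with a positive cofactor. *)
rewrite -subr_ge0 (_ : _ - _ = (q - p) * (gamma * p * q + theta * (q + p))).
  by rewrite mulr_ge0 ?subr_ge0// ltW// addr_gt0// !(mulr_gt0, addr_gt0).
ring.
Qed.

Variables (c D : R) (c_gt0 : 0 < c) (D_ge0 : 0 <= D).
Hypothesis c_lt : c < (theta * gamma)^-1.

(** Let [h] be S minus the right-hand side. At c it is at most 0 because D >= 0; at b = 1/(theta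
    gamma) [gap] vanishes and it equals b - c > 0. Hence there is a root, and it is not b. *)
Lemma fixpoint_exists : exists S, [/\ c <= S, S < (theta * gamma)^-1 &
  S = c * (D / Gamma S theta gamma ^+ 2 + 1)].
Proof.
set b := (theta * gamma)^-1; have cb : c < b := c_lt.
have tg0 : 0 < theta * gamma by rewrite mulr_gt0.
pose h S := S - c * (D * gap S ^+ 2 + 1).
have qge S : S <= b -> 0 <= 1 - theta * gamma * S.
  by rewrite subr_ge0 -(ler_pdivlMl _ _ tg0) mulr1.
have ch : {within `[c, b], continuous h}.
  apply: derivable_within_continuous => x; rewrite in_itv/= => /andP[_ xb].
  pose q S := 1 - theta * gamma * S; pose den S := gamma * q S + theta.
  have den0 : den x != 0.
    by rewrite gt_eqF// ltr_wpDl// mulr_ge0 ?qge// ltW.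
  have dcst (k : R) : derivable (cst k) x (1 : R) := derivable_cst k x 1.
  have did : derivable id x 1 := @derivable_id R R x 1.
  have dq : derivable q x 1.
    exact (derivableB (dcst 1) (derivableM (dcst (theta * gamma)) did)).
  have dden : derivable den x 1.
    exact (derivableD (derivableM (dcst gamma) dq) (dcst theta)).
  have dgap : derivable gap x 1.
    exact: (derivableM (derivableM dq dq) (derivableV den0 dden)).
  exact (derivableB did (derivableM (dcst c)
    (derivableD (derivableM (dcst D) (derivableM dgap dgap)) (dcst 1)))).
have hc : h c <= 0.
  rewrite /h subr_le0 ler_pMr// lerDr.
  by rewrite mulr_ge0// sqr_ge0.
have hb : h b = b - c.
  rewrite /h /gap /b mulfV ?gt_eqF// subrr expr0n mul0r expr0n !mulr0 add0r.
  by rewrite mulr1.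
have [|S] := @IVT R h c b 0 (ltW cb) ch.
  by rewrite ge_min hc/= le_max hb (subr_ge0 c b) (ltW cb) orbT.
rewrite in_itv/= => /andP[cS Sb] hS; exists S.
have Sne : S != b.
  by apply: contraPneq hS => ->; rewrite hb => /eqP; rewrite subr_eq0 gt_eqF.
split => //; first by rewrite lt_neqAle Sne.
by apply/eqP; rewrite -subr_eq0 -exprVn Gamma_inv -/(h S) hS.
Qed.

(** The right-hand side is nonincreasing, so S <= V between two solutions forces V <= S. *)
Lemma fixpoint_unique S V :
  S < (theta * gamma)^-1 -> S = c * (D / Gamma S theta gamma ^+ 2 + 1) ->
  V < (theta * gamma)^-1 -> V = c * (D / Gamma V theta gamma ^+ 2 + 1) ->
  S = V.
Proof.
wlog SV : S V / S <= V => [wl|] Sb SE Vb VE.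
  by have [SV|/ltW VS] := leP S V; [exact: wl|exact/esym/wl].
apply/eqP; rewrite eq_le SV/= [leLHS]VE [leRHS]SE ler_pM2l// lerD2r.
rewrite ler_wpM2l// -!exprVn lerXn2r ?ler_invGamma//.
- by rewrite nnegrE invr_ge0 ltW// Gamma_gt0.
- by rewrite nnegrE invr_ge0 ltW// Gamma_gt0.
Qed.

End RiskCost.

(** * Closed form of the objective *)

Section WorstCase.
Context {R : realType} {n : nat} {d : measure_display} {T : measurableType d}.
Variables (P : probability T R) (X : T -> 'cV[R]_n).
Variables (mu : 'cV[R]_n) (Sigma : 'M[R]_n).
Hypotheses (Sigma_pd : sym_posdef Sigma).
Hypotheses (X_normal : normal_vector P X mu Sigma).
Variables (gamma theta : R) (gamma_gt0 : 0 < gamma).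

Let dotX (a : 'cV[R]_n) (w : T) : measurableTypeR R := dot a (X w).

Let measurable_dotX a : measurable_fun setT (dotX a).
Proof.
have -> : dotX a = (fun w => \sum_i a i 0 * X w i 0).
  by apply/funext => w; rewrite /dotX /dot mxE; under eq_bigr do rewrite mxE.
apply: measurable_sum => i; apply: measurable_funM => //.
exact: X_normal.1.
Qed.

HB.instance Definition _ a :=
  isMeasurableFun.Build _ _ _ _ (dotX a) (measurable_dotX a).

Lemma worst_caseE (a : 'cV[R]_n) : domain gamma Sigma (theta, a) ->
  worst_case P X gamma theta mu a =
  (variance_cost theta gamma (bilin Sigma a a) - dot a mu)%:E.
Proof.
move=> [/= theta_gt0 a1 a_dom]; have a0 := portfolio_neq0 a1.
set v := bilin Sigma a a in a_dom *; have v0 : 0 < v by exact: Sigma_pd.2.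
have q0 : 0 < 1 - theta * gamma * v.
  by rewrite subr_gt0 mulrAC -ltr_pdivlMr// div1r.
pose f y := (expR (theta * (gamma / 2 * (y - dot a mu) ^+ 2 - y)))%:E : \bar R.
have mf : measurable_fun setT (f : measurableTypeR R -> \bar R).
  apply/measurable_EFinP/measurableT_comp => //.
  apply: measurable_funM => //; apply: measurable_funB => //.
  apply: measurable_funM => //; apply: measurable_funX.
  exact: measurable_funB.
rewrite /worst_case.
(* Only the law of a^T X matters, so the expectation becomes a univariate normal integral. *)
have -> : ('E_P[fun w => expR (theta * MV gamma mu a (X w))%R])%E =
    (\int[normal_prob (dot a mu) (Num.sqrt v)]_y f y)%E.
  rewrite unlock; under eq_integral do rewrite MVE -/(f (dotX a _)).
  apply: ge0_integral_law => // [E mE|y]; last by rewrite lee_fin expR_ge0.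
  exact: (X_normal.2 _ a0 _ mE).
rewrite integral_expR_normal_prob// lne_EFin; last first.
  by rewrite mulr_gt0 ?expR_gt0// invr_gt0 sqrtr_gt0.
rewrite lnM ?posrE ?expR_gt0 ?invr_gt0 ?sqrtr_gt0// expRK.
rewrite lnV ?posrE ?sqrtr_gt0//.
have -> : ln (Num.sqrt (1 - theta * gamma * v)) =
    ln (1 - theta * gamma * v) / 2.
  by rewrite -[in RHS](sqr_sqrtr (ltW q0)) lnXn ?sqrtr_gt0//; field.
rewrite -EFinM /variance_cost; congr EFin; field.
by rewrite !gt_eqF.
Qed.

End WorstCase.

(** * Minimisation over the domain *)

Lemma arg_inf_strict_min (R : realType) (U : Type) (D : set U)
    (f : U -> \bar R) (x : U) :
  D x -> (forall y, D y -> y <> x -> (f x < f y)%E) -> arg_inf D f = [set x].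
Proof.
move=> Dx f_min.
have infE : ereal_inf (f @` D) = f x.
  apply/eqP; rewrite eq_le; apply/andP; split.
    by apply: ereal_inf_lbound; exists x.
  apply: le_ereal_inf_tmp => _ [y Dy <-].
  by have [->//|yx] := pselect (y = x); exact/ltW/f_min.
apply/seteqP; split => y /=; last by move=> ->; split.
move=> [Dy]; rewrite infE => fy; apply: contrapT => yx.
by have := f_min _ Dy yx; rewrite fy ltxx.
Qed.

Theorem theorem5 (R : realType) (n : nat) (n_ge1 : (1 <= n)%N)
  (mu : 'cV[R]_n) (Sigma : 'M[R]_n) (Sigma_pd : sym_posdef Sigma)
  (gamma : R) (gamma_gt0 : 0 < gamma)
  (d : measure_display) (T : measurableType d) (P : probability T R)
  (X : T -> 'cV[R]_n) (X_normal : normal_vector P X mu Sigma)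
  (theta : R) (theta_gt0 : 0 < theta)
  (theta_feasible : exists a : 'cV[R]_n, domain gamma Sigma (theta, a)) :
  exists Sstar : R,
    [/\ solves_S theta gamma Sigma mu Sstar,
        forall S : R, solves_S theta gamma Sigma mu S -> S = Sstar &
        arg_inf [set a : 'cV[R]_n | domain gamma Sigma (theta, a)]
                (worst_case P X gamma theta mu)
        = [set opt_portfolio theta gamma Sigma mu Sstar]].
Proof.
have C_gt0 := constC_gt0 Sigma_pd n_ge1.
have D_ge0 := constD_ge0 mu Sigma_pd n_ge1.
have domE a : portfolio a -> domain gamma Sigma (theta, a) <->
    bilin Sigma a a < (theta * gamma)^-1.
  move=> a1; rewrite /domain/= invfM ltr_pdivlMl//.
  by split=> [[]//|?]; split.
(* Feasibility makes the search interval for S nonempty, as every portfolio has variance at least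
   1/C. *)
have C_lt : (constC Sigma)^-1 < (theta * gamma)^-1.
  have [a a_dom] := theta_feasible; have a1 : portfolio a by case: a_dom.
  have a_lt := (domE _ a1).1 a_dom.
  exact: le_lt_trans (bilin_portfolio_ge Sigma_pd n_ge1 a1) a_lt.
have CV_gt0 : 0 < (constC Sigma)^-1 by rewrite invr_gt0.
have [S S_sol] := fixpoint_exists theta_gt0 gamma_gt0 CV_gt0 D_ge0 C_lt.
have [CS S_lt S_eq] := S_sol.
exists S; split => //.
  move=> V [_ V_lt V_eq].
  exact: (fixpoint_unique theta_gt0 gamma_gt0 CV_gt0 D_ge0).
set G := Gamma S theta gamma in S_eq *.
have G_gt0 : 0 < G by exact: Gamma_gt0.
set o := opt_portfolio _ _ _ _ _.
have oE : o = frontier mu Sigma G^-1 by [].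
have o1 : portfolio o by rewrite oE; exact: portfolio_frontier.
have oS : bilin Sigma o o = S.
  by rewrite oE bilin_frontier// exprVn -S_eq.
have o_dom : domain gamma Sigma (theta, o) by apply/domE; rewrite ?oS.
apply: arg_inf_strict_min => //= a a_dom /eqP ao.
have a1 : portfolio a by case: a_dom.
rewrite !(worst_caseE Sigma_pd X_normal gamma_gt0)// lte_fin oS.
have a_lt := (domE _ a1).1 a_dom.
have tangent := variance_cost_tangent theta_gt0 gamma_gt0 S_lt a_lt.
have := bilin_sub_frontier mu Sigma_pd n_ge1 G^-1 a1; rewrite -oE oS => gap.
have gap_gt0 : 0 < bilin Sigma (a - o) (a - o).
  by apply: Sigma_pd.2; rewrite subr_eq0.
move: tangent; rewrite gap -/G.
(* The slope G/2 cancels the factor 2/G, so the mean terms match those of the objective and a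
   positive quadratic term remains. *)
rewrite (_ : G / 2 * _ = dot a mu - dot o mu
    + G / 2 * bilin Sigma (a - o) (a - o)); last by field; rewrite gt_eqF.
have : 0 < G / 2 * bilin Sigma (a - o) (a - o) by rewrite mulr_gt0// divr_gt0.
lra.
Qed.
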